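(* Let $k\ge 3$ and $n\ge k$ be integers, and let $C_{k,n}>0$ be a real number satisfying $$C_{k,n}<\frac{2n}{n(k-2)-k}$$ (for $k=n=3$, where the denominator is $0$, the right-hand side is read as $+\infty$). Consider estimating the parameter $\boldsymbol\theta=(\theta_1,\dots,\theta_k)\in E_k$ of the $k$-class multinomial distribution from a simple random sample of size $n$, under squared error loss. Let $\boldsymbol{\hat\theta}$ be the maximum likelihood estimator and let $\boldsymbol d_B$ be the Bayes estimator under the prior $\mathrm{Dir}(C_{k,n},\dots,C_{k,n})$. Then the proportion of the parameter space where the Bayes estimator has lower risk than the MLE satisfies $$\frac{\mathrm{Vol}\left(\{\boldsymbol\theta\in E_k:\ R(\boldsymbol d_B,\boldsymbol\theta)<R(\boldsymbol{\hat\theta},\boldsymbol\theta)\}\right)}{\mathrm{Vol}(E_k)}>1-k\left(\frac14\right)^{\frac{k-1}{2}}.$$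
   Context: The parameter space is the simplex $E_k=\{\boldsymbol\theta=(\theta_1,\dots,\theta_k)\in\mathbb{R}^k:\ \theta_i\ge 0\ \forall i,\ \sum_{i=1}^k\theta_i=1\}$, and $\mathrm{Vol}$ denotes $(k-1)$-dimensional volume (surface area, i.e. $(k-1)$-dimensional Hausdorff measure) on $E_k$. The observation is the vector of class counts $(n_1,\dots,n_k)$, with $n_i$ nonnegative integers summing to $n$, having the multinomial distribution with probability mass function $\frac{n!}{n_1!\cdots n_k!}\theta_1^{n_1}\cdots\theta_k^{n_k}$ (with $0^0=1$). The maximum likelihood estimator is $\boldsymbol{\hat\theta}=(n_1/n,\dots,n_k/n)$. The Dirichlet prior $\mathrm{Dir}(\alpha_1,\dots,\alpha_k)$ (all $\alpha_i>0$) has density proportional to $\theta_1^{\alpha_1-1}\cdots\theta_k^{\alpha_k-1}$ on the simplex. Under the prior with $\alpha_1=\dots=\alpha_k=C_{k,n}$ and squared error loss, the Bayes estimator (posterior mean) is $\boldsymbol d_B=(d_{B1},\dots,d_{Bk})$ with $d_{Bi}=\frac{n_i+C_{k,n}}{n+kC_{k,n}}$. The squared error loss is $L(\boldsymbol\theta,\boldsymbol\theta')=\sum_{i=1}^k(\theta_i-\theta_i')^2$, and the risk of an estimator $\boldsymbol d$ at $\boldsymbol\theta$ is $R(\boldsymbol d,\boldsymbol\theta)=E_{\boldsymbol\theta}\left[\sum_{i=1}^k(d_i-\theta_i)^2\right]$, the expectation being over the multinomial distribution of $(n_1,\dots,n_k)$ with parameter $\boldsymbol\theta$. *)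

(* Defs.v *)
From HB Require Import structures.
From mathcomp Require Import all_boot all_order all_algebra.
From mathcomp Require Import all_classical all_reals all_analysis.
Set Implicit Arguments.
Unset Strict Implicit.
Unset Printing Implicit Defensive.
Import Order.TTheory GRing.Theory Num.Theory.
Local Open Scope classical_set_scope.
Local Open Scope ring_scope.

Definition simplex (R : realType) (k : nat) : set 'rV[R]_k :=
  [set t | (forall i, 0 <= t 0 i) /\ \sum_(i < k) t 0 i = 1].
Arguments simplex R k : clear implicits.

Definition sqloss (R : realType) (k : nat) (t t' : 'rV[R]_k) : R :=
  \sum_(i < k) (t 0 i - t' 0 i) ^+ 2.

(* The library norm on 'rV[R]_k is the sup norm, hence this distance. *)
Definition euclidean_dist (R : realType) (k : nat) (x y : 'rV[R]_k) : R :=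
  Num.sqrt (\sum_(i < k) (x 0 i - y 0 i) ^+ 2).

(* -oo when U is empty *)
Definition diam (R : realType) (k : nat) (U : set 'rV[R]_k) : \bar R :=
  ereal_sup [set (euclidean_dist x y)%:E | x in U & y in U].

(* diam(U)^m, with the convention that the empty set contributes 0, also
   when m = 0. *)
Definition diam_pow (R : realType) (k m : nat) (U : set 'rV[R]_k) : \bar R :=
  if `[< U = set0 >] then 0%E else (diam U ^+ m)%E.

Definition hausdorff_delta (R : realType) (k m : nat) (delta : R)
    (A : set 'rV[R]_k) : \bar R :=
  ereal_inf [set (\sum_(0 <= j <oo) diam_pow m (U j))%E
    | U in [set U : (set 'rV[R]_k)^nat |
        A `<=` \bigcup_j U j /\ forall j, (diam (U j) <= delta%:E)%E]].

(* Volume of the Euclidean unit ball of R^m,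
   i.e. pi^(m/2) / Gamma(m/2 + 1). *)
Fixpoint unit_ball_volume (R : realType) (m : nat) : R :=
  match m with
  | 0 => 1
  | 1 => 2
  | m'.+2 => 2 * pi / m'.+2%:R * unit_ball_volume R m'
  end.

(* m-dimensional Hausdorff (outer) measure, normalized so as to agree with
   m-dimensional Lebesgue measure (surface area) on m-dimensional planes; the
   supremum over delta > 0 is the limit as delta tends to 0. *)
Definition hausdorff_measure (R : realType) (k m : nat)
    (A : set 'rV[R]_k) : \bar R :=
  ((unit_ball_volume R m / 2 ^+ m)%:E *
   ereal_sup [set hausdorff_delta m delta A | delta in [set d : R | (0 < d)%R]])%E.

(* Infinite volume would be sent to 0 by fine; the simplex has finite volume. *)
Definition Vol (R : realType) (k : nat) (A : set 'rV[R]_k) : R :=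
  fine (hausdorff_measure k.-1 A).

(* Class counts: vectors c with \sum_i c i = n, this constraint being imposed
   in the expectation below. *)
Definition counts (k n : nat) := {ffun 'I_k -> 'I_n.+1}.

Definition multinomial_pmf (R : realType) (k n : nat) (t : 'rV[R]_k)
    (c : counts k n) : R :=
  n`!%:R / (\prod_(i < k) (c i)`!)%N%:R * \prod_(i < k) t 0 i ^+ c i.

Definition multinomial_expectation (R : realType) (k n : nat) (t : 'rV[R]_k)
    (f : counts k n -> R) : R :=
  \sum_(c : counts k n | (\sum_(i < k) c i == n)%N) multinomial_pmf t c * f c.

Definition estimator (R : realType) (k n : nat) := counts k n -> 'rV[R]_k.

Definition risk (R : realType) (k n : nat) (d : estimator R k n)
    (t : 'rV[R]_k) : R :=
  multinomial_expectation t (fun c => sqloss (d c) t).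

Definition mle (R : realType) (k n : nat) : estimator R k n :=
  fun c => \row_i ((c i)%:R / n%:R).
Arguments mle R k n : clear implicits.

(* Posterior mean under the prior Dir(C, ..., C): the posterior given the
   counts c is Dir(C + c_1, ..., C + c_k). *)
Definition dirichlet_bayes (R : realType) (k n : nat) (C : R) :
    estimator R k n :=
  fun c => \row_i (((c i)%:R + C) / (n%:R + k%:R * C)).
Arguments dirichlet_bayes {R} k n C.

(* Main.v *)
Require Import Defs.
From HB Require Import structures.
From mathcomp Require Import all_boot all_order all_algebra.
From mathcomp Require Import all_classical all_reals all_analysis.
From mathcomp Require Import ring lra zify.
Set Implicit Arguments.
Unset Strict Implicit.
Unset Printing Implicit Defensive.
Import Order.TTheory GRing.Theory Num.Theory.
Local Open Scope classical_set_scope.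
Local Open Scope ring_scope.

(* Write S for the sum of the theta_i^2.  The first two moments of the
   multinomial distribution give both risks as affine functions of S, and the
   Bayes risk is the smaller one exactly when S < T, with
   T = (2n + kC + nC) / (2n + kC + nkC); the bound on C says that T > 1/2.
   Since S <= max theta_i, the bad set is covered by the k corners
   {theta_i >= T}.  Each corner is the image of the simplex under a similarity
   of ratio 1 - T < 1/2, hence has volume at most (1 - T)^(k-1) Vol(E_k).
   Subadditivity of Hausdorff measure concludes, once Vol(E_k) is known to be
   finite (cover by small grid cells) and positive (compactness and counting
   of grid points). *)

(** * Moments of the multinomial distribution and risks *)

Section Multinomial.
Variables (R : realType) (k : nat) (t : 'rV[R]_k).

(** One observation of class i is added or removed. As counts live in a bounded ordinal, [decr] is
    meaningful only if every decremented entry is at most n, which holds when c sums to n + 1 and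
    c_i > 0. *)
Let incr n (i : 'I_k) (c : counts k n) : counts k n.+1 :=
  [ffun j => inord (c j + (j == i))].
Let decr n (i : 'I_k) (c : counts k n.+1) : counts k n :=
  [ffun j => inord (c j - (j == i))].

Let incrE n (i : 'I_k) (c : counts k n) j :
  incr i c j = (c j + (j == i))%N :> nat.
Proof.
by rewrite ffunE inordK //; have := ltn_ord (c j); case: (j == i); lia.
Qed.

(** Pointwise size biasing: the extra observation multiplies n! by n + 1, c_i! by c_i + 1 and the
    monomial by t_i. *)
Lemma multinomial_pmf_incr n (i : 'I_k) (c : counts k n) (x : R) :
  multinomial_pmf t (incr i c) * ((c i).+1%:R * x) =
  n.+1%:R * t 0 i * (multinomial_pmf t c * x).
Proof.
rewrite /multinomial_pmf; set P := (\prod_(j < k | j != i) (c j)`!)%N.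
have -> : (\prod_j (incr i c j)`! = (c i).+1`! * P)%N.
  rewrite (bigD1 i) //= incrE eqxx addn1; congr (_ * _)%N.
  by apply: eq_bigr => j /negbTE ji; rewrite incrE ji addn0.
have -> : (\prod_j (c j)`! = (c i)`! * P)%N by rewrite (bigD1 i).
have -> : \prod_j t 0 j ^+ incr i c j =
          t 0 i ^+ (c i).+1 * \prod_(j < k | j != i) t 0 j ^+ c j.
  rewrite (bigD1 i) //= incrE eqxx addn1; congr (_ * _).
  by apply: eq_bigr => j /negbTE ji; rewrite incrE ji addn0.
have -> : \prod_j t 0 j ^+ c j =
          t 0 i ^+ c i * \prod_(j < k | j != i) t 0 j ^+ c j.
  by rewrite (bigD1 i).
have P0 : P%:R != 0 :> R.
  by rewrite pnatr_eq0 -lt0n prodn_gt0 // => j; rewrite fact_gt0.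
have F0 : (c i)`!%:R != 0 :> R by rewrite pnatr_eq0 -lt0n fact_gt0.
have S0 : 1 + (c i)%:R != 0 :> R by rewrite addrC natr1 pnatr_eq0.
rewrite !factS !natrM exprS -!natr1; field.
by rewrite P0 F0 addrC S0.
Qed.

(* Size biasing: removing one observation of class i from the sample turns
   n! / c! theta^c into n theta_i times the probability of what is left. *)
Lemma multinomial_expectation_size_bias n (i : 'I_k) (g : nat -> R) :
  multinomial_expectation t (fun c : counts k n.+1 => (c i)%:R * g (c i)) =
  n.+1%:R * t 0 i *
    multinomial_expectation t (fun c : counts k n => g (c i).+1).
Proof.
(* Terms with c_i = 0 vanish because of the factor c_i; the others are exactly the images of
   [incr i]. *)
rewrite /multinomial_expectation (bigID (fun c : counts _ _ => c i == ord0)) /=.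
rewrite big1 ?add0r => [|c /andP[_ /eqP ->]]; last by rewrite mul0r mulr0.
have sumE n' (c : counts k n') :
    (\sum_j incr i c j = (\sum_j c j).+1)%N.
  under eq_bigr do rewrite incrE.
  rewrite big_split /=; rewrite (_ : (\sum_j (j == i) = 1)%N) ?addn1 //.
  by rewrite (bigD1 i) //= eqxx big1 // => j /negbTE ->.
rewrite (reindex_onto (@incr n i) (@decr n i)) /=; last first.
  move=> c /andP[/eqP cn ci].
  have ci0 : (0 < c i)%N by rewrite lt0n; apply: contra ci => /eqP H; apply/eqP/val_inj.
  apply/ffunP => j; apply/val_inj; rewrite /= incrE ffunE.
  (* No truncation by [inord]: for j different from i, c_j + c_i <= n + 1 with c_i > 0 forces c_j <=
     n. *)
  have Hj : (c j - (j == i) < n.+1)%N.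
    have [->|ji] := eqVneq j i; first by have := ltn_ord (c i); lia.
    by move: cn; rewrite (bigD1 j) //= (bigD1 i) 1?eq_sym //=; lia.
  rewrite inordK // subnK //.
  by have [->|] := eqVneq j i.
rewrite mulr_sumr; apply: eq_big => [c|c /andP[/andP[/eqP cn _] _]].
  rewrite sumE eqSS -(inj_eq val_inj) /= incrE eqxx addn1 /= andbT.
  rewrite andb_idr // => _; apply/eqP/ffunP => j; apply/val_inj.
  by rewrite ffunE incrE addnK inord_val.
rewrite incrE eqxx addn1 multinomial_pmf_incr //.
Qed.

Hypothesis t1 : \sum_(i < k) t 0 i = 1.

(** Induction on n in place of the multinomial theorem: writing n + 1 as the sum of the c_i, size
    biasing turns (n + 1) E[x] into the sum of the (n + 1) t_i x. *)
Lemma multinomial_expectation_cst n (x : R) :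
  multinomial_expectation t (fun _ : counts k n => x) = x.
Proof.
elim: n => [|n IH].
  rewrite /multinomial_expectation (bigD1 [ffun => ord0]) /=; last first.
    by rewrite big1 // => i _; rewrite ffunE.
  rewrite big1 ?addr0 => [|c /andP[_ /eqP[]]]; last first.
    by apply/ffunP => i; rewrite ffunE ord1.
  rewrite /multinomial_pmf !big1 => [|i _|i _]; rewrite ?ffunE ?expr0 //.
  by rewrite divr1 !mul1r.
have n0 : n.+1%:R != 0 :> R by rewrite pnatr_eq0.
apply: (mulfI n0).
transitivity (\sum_(i < k)
    multinomial_expectation t (fun c : counts k n.+1 => (c i)%:R * x)).
  rewrite /multinomial_expectation exchange_big /= mulr_sumr.
  apply: eq_bigr => c /eqP cn; rewrite -mulr_sumr -mulr_suml -natr_sum cn.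
  by rewrite mulrCA.
under eq_bigr do rewrite (@multinomial_expectation_size_bias n _ (fun=> x)) IH.
by rewrite -mulr_suml -mulr_sumr t1 mulr1.
Qed.

Lemma multinomial_expectationD n (f g : counts k n -> R) :
  multinomial_expectation t (fun c => f c + g c) =
  multinomial_expectation t f + multinomial_expectation t g.
Proof.
by rewrite /multinomial_expectation -big_split; apply: eq_bigr => c _; rewrite mulrDr.
Qed.

Lemma multinomial_expectationZ n (a : R) (f : counts k n -> R) :
  multinomial_expectation t (fun c => a * f c) = a * multinomial_expectation t f.
Proof. by rewrite /multinomial_expectation mulr_sumr; apply: eq_bigr => c _; rewrite mulrCA. Qed.

Lemma multinomial_expectation_count n (i : 'I_k) :
  multinomial_expectation t (fun c : counts k n => (c i)%:R) = n%:R * t 0 i.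
Proof.
case: n => [|n].
  rewrite mul0r /multinomial_expectation big1 // => c _.
  by rewrite (ord1 (c i)) mulr0.
have := multinomial_expectation_size_bias n i (fun=> 1).
rewrite multinomial_expectation_cst mulr1 => <-.
by congr multinomial_expectation; apply/funext => c; rewrite mulr1.
Qed.

Lemma multinomial_expectation_count_sq n (i : 'I_k) :
  multinomial_expectation t (fun c : counts k n => (c i)%:R ^+ 2) =
  n%:R * t 0 i * ((n%:R - 1) * t 0 i + 1).
Proof.
case: n => [|n].
  rewrite !mul0r /multinomial_expectation big1 // => c _.
  by rewrite (ord1 (c i)) expr0n /= mulr0.
rewrite (multinomial_expectation_size_bias n i (fun x => x%:R)).
under [X in multinomial_expectation t X]funext do rewrite -natr1.
rewrite multinomial_expectationD multinomial_expectation_count.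
by rewrite multinomial_expectation_cst -natr1 addrK.
Qed.

(** Treats both estimators at once: a = 0, b = n is the MLE, and a = C, b = n + kC the Bayes
    estimator. The two summands are variance and squared bias. *)
Lemma risk_affine n (a b : R) : b != 0 ->
  risk (fun c : counts k n => \row_i (((c i)%:R + a) / b)) t =
  (n%:R * (1 - \sum_i t 0 i ^+ 2) +
    \sum_i (a - (b - n%:R) * t 0 i) ^+ 2) / b ^+ 2.
Proof.
move=> b0; rewrite /risk /sqloss.
transitivity (\sum_i multinomial_expectation t
   (fun c : counts k n => (((c i)%:R + a) / b - t 0 i) ^+ 2)).
  rewrite /multinomial_expectation exchange_big /=.
  apply: eq_bigr => c _; rewrite mulr_sumr.
  by apply: eq_bigr => i _; rewrite mxE.
have -> : 1 - \sum_i t 0 i ^+ 2 = \sum_i (t 0 i - t 0 i ^+ 2).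
  by rewrite sumrB t1.
rewrite mulr_sumr -big_split /= mulr_suml; apply: eq_bigr => i _.
have -> : (fun c : counts k n => (((c i)%:R + a) / b - t 0 i) ^+ 2) =
    (fun c => b^-2 * ((c i)%:R ^+ 2 + ((a - b * t 0 i) *+ 2 * (c i)%:R
                      + (a - b * t 0 i) ^+ 2))).
  by apply/funext => c; field.
rewrite multinomial_expectationZ 2!multinomial_expectationD.
rewrite multinomial_expectationZ multinomial_expectation_count_sq.
rewrite multinomial_expectation_count multinomial_expectation_cst.
by field.
Qed.

End Multinomial.

(** * Hausdorff measure *)

(** Serves to merge two countable covers into one; partial sums of even length regroup into
    pairs. *)
Lemma nneseries_interleave_le (R : realType) (a b : (\bar R)^nat) :
  (forall j, 0 <= a j)%E -> (forall j, 0 <= b j)%E ->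
  (\sum_(0 <= j <oo) (if odd j then b j./2 else a j./2) <=
   \sum_(0 <= j <oo) a j + \sum_(0 <= j <oo) b j)%E.
Proof.
move=> a0 b0; set f := fun j => if odd j then b j./2 else a j./2.
have f0 j : (0 <= f j)%E by rewrite /f; case: odd.
have fE n : (\sum_(0 <= j < n.*2) f j = \sum_(0 <= j < n) (a j + b j))%E.
  elim: n => [|n IH]; first by rewrite !big_geq.
  rewrite doubleS !big_nat_recr //= IH -addrA /f /= odd_double /=.
  by rewrite doubleK uphalf_double.
apply: lime_le; first by apply: is_cvg_nneseries => j _ _; exact: f0.
apply: nearW => n.
apply: (@le_trans _ _ (\sum_(0 <= j < n.*2) f j)%E).
  by apply: lee_sum_nneg_natr => [j _ _|]; [exact: f0 | lia].
rewrite fE -nneseriesD //.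
by apply: nneseries_lim_ge => j _ _; rewrite adde_ge0.
Qed.

Lemma bigcup_finType (T : Type) (I : finType) (A : I -> set T) :
  \bigcup_i A i = \big[setU/set0]_i A i.
Proof.
rewrite -bigcup_seq (_ : [set` index_enum I] = setT) //.
by apply/seteqP; split => // i _; exact: mem_index_enum.
Qed.

Section EuclideanDist.
Variables (R : realType) (k : nat).
Implicit Types x y : 'rV[R]_k.

Lemma euclidean_dist_ge0 x y : 0 <= euclidean_dist x y.
Proof. exact: sqrtr_ge0. Qed.

Lemma euclidean_dist_le x y (d : R) : 0 <= d ->
  \sum_i (x 0 i - y 0 i) ^+ 2 <= d ^+ 2 -> euclidean_dist x y <= d.
Proof.
by move=> d0 h; rewrite -(ger0_norm d0) -sqrtr_sqr ler_sqrt ?sqr_ge0.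
Qed.

Lemma le_euclidean_dist x y i : `|x 0 i - y 0 i| <= euclidean_dist x y.
Proof.
rewrite -sqrtr_sqr ler_sqrt; last by apply: sumr_ge0 => j _; exact: sqr_ge0.
by rewrite (bigD1 i) //= lerDl; apply: sumr_ge0 => j _; exact: sqr_ge0.
Qed.

Lemma le_diam (U : set 'rV[R]_k) x y : U x -> U y ->
  ((euclidean_dist x y)%:E <= diam U)%E.
Proof. by move=> Ux Uy; apply: ereal_sup_ubound; exists x => //; exists y. Qed.

Lemma diam_le (U : set 'rV[R]_k) (d : \bar R) :
  (forall x y, U x -> U y -> ((euclidean_dist x y)%:E <= d)%E) ->
  (diam U <= d)%E.
Proof. by move=> h; apply: ge_ereal_sup => _ [x Ux [y Uy <-]]; exact: h. Qed.

Lemma diam_ge0 (U : set 'rV[R]_k) : U !=set0 -> (0 <= diam U)%E.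
Proof.
case=> x Ux; apply: le_trans (le_diam Ux Ux).
by rewrite lee_fin euclidean_dist_ge0.
Qed.

Lemma diam_set0 : diam (set0 : set 'rV[R]_k) = -oo%E.
Proof.
rewrite /diam (_ : [set _ | _ in _ & _ in _] = set0) ?ereal_sup0 //.
by apply/seteqP; split => // z [].
Qed.

Lemma fine_diam_ge0 (U : set 'rV[R]_k) : 0 <= fine (diam U).
Proof.
have [->|/set0P U0] := eqVneq U set0; first by rewrite diam_set0.
by rewrite fine_ge0 // diam_ge0.
Qed.

Lemma diam_pow_ge0 m (U : set 'rV[R]_k) : (0 <= diam_pow m U)%E.
Proof.
rewrite /diam_pow; case: asboolP => // /eqP/set0P U0.
by rewrite expe_ge0 // diam_ge0.
Qed.

Lemma lee_expe (x y : \bar R) m : (0 <= x -> x <= y -> x ^+ m <= y ^+ m)%E.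
Proof.
move=> x0 xy; elim: m => [|m IH]; first by rewrite !expe0.
by rewrite !expeS lee_pmul // expe_ge0.
Qed.

Lemma diam_pow_le m (U : set 'rV[R]_k) (d : R) : (0 <= d)%R ->
  (diam U <= d%:E)%E -> (diam_pow m U <= (d ^+ m)%:E)%E.
Proof.
move=> d0 Ud; rewrite /diam_pow; case: asboolP => [_|/eqP/set0P U0].
  by rewrite lee_fin exprn_ge0.
by rewrite EFin_expe lee_expe // diam_ge0.
Qed.

(* The junk value [fine (diam set0) = fine -oo = 0] is the right one. *)
Lemma diam_powE m (U : set 'rV[R]_k) (d : R) : (0 < m)%N ->
  (diam U <= d%:E)%E -> diam_pow m U = (fine (diam U) ^+ m)%:E.
Proof.
move=> m0 Ud; rewrite /diam_pow; case: asboolP => [->|/eqP/set0P U0].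
  by rewrite diam_set0 expr0n -(prednK m0).
rewrite EFin_expe fineK // fin_numE -ltey (le_lt_trans Ud) ?ltry // andbT.
by rewrite gt_eqF // (lt_le_trans _ (diam_ge0 U0)).
Qed.

Lemma diam_image_le (r : R) (g : 'rV[R]_k -> 'rV[R]_k) (U : set 'rV[R]_k) :
  0 < r ->
  (forall x y, euclidean_dist (g x) (g y) <= r * euclidean_dist x y) ->
  (diam (g @` U) <= r%:E * diam U)%E.
Proof.
move=> r0 gr; apply: diam_le => _ _ [x Ux <-] [y Uy <-].
apply: (@le_trans _ _ (r%:E * (euclidean_dist x y)%:E)%E).
  by rewrite -EFinM lee_fin.
by rewrite lee_pmul2l ?lte_fin // le_diam.
Qed.

Lemma diam_pow_image_le m (r : R) (g : 'rV[R]_k -> 'rV[R]_k)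
    (U : set 'rV[R]_k) : 0 < r ->
  (forall x y, euclidean_dist (g x) (g y) <= r * euclidean_dist x y) ->
  (diam_pow m (g @` U) <= (r ^+ m)%:E * diam_pow m U)%E.
Proof.
move=> r0 gr; rewrite {2}/diam_pow; case: asboolP => [->|/eqP/set0P U0].
  by rewrite image_set0 mule0 /diam_pow asboolT.
have gU0 : g @` U !=set0 by case: U0 => x Ux; exists (g x); exists x.
rewrite /diam_pow asboolF; last by apply/eqP/set0P.
apply: (@le_trans _ _ ((r%:E * diam U) ^+ m)%E).
  by rewrite lee_expe ?diam_ge0 // diam_image_le.
elim: m => [|m IH]; first by rewrite !expe0 mule1.
rewrite !expeS exprS EFinM -!muleA lee_pmul2l ?lte_fin //.
by rewrite muleCA lee_wpmul2l // diam_ge0.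
Qed.

End EuclideanDist.

Section HausdorffDelta.
Variables (R : realType) (k m : nat) (delta : R).
Implicit Types A B : set 'rV[R]_k.

Lemma hausdorff_delta_ge0 A : (0 <= hausdorff_delta m delta A)%E.
Proof.
apply: le_ereal_inf_tmp => _ [U _ <-].
by apply: nneseries_ge0 => j _ _; exact: diam_pow_ge0.
Qed.

Lemma hausdorff_delta_le A (U : (set 'rV[R]_k)^nat) :
  A `<=` \bigcup_j U j -> (forall j, (diam (U j) <= delta%:E)%E) ->
  (hausdorff_delta m delta A <= \sum_(0 <= j <oo) diam_pow m (U j))%E.
Proof. by move=> AU Ud; apply: ereal_inf_lbound; exists U. Qed.

Lemma le_hausdorff_delta A B : A `<=` B ->
  (hausdorff_delta m delta A <= hausdorff_delta m delta B)%E.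
Proof.
move=> AB; apply: ereal_inf_le_tmp => _ [U [BU Ud] <-].
by exists U => //; split => //; exact: subset_trans BU.
Qed.

Lemma hausdorff_deltaU A B :
  (hausdorff_delta m delta (A `|` B) <=
   hausdorff_delta m delta A + hausdorff_delta m delta B)%E.
Proof.
(* Infinite values make the bound trivial; finite ones allow covers within e / 2 of the infimum,
   which are then interleaved. *)
have [|Aoo] := eqVneq (hausdorff_delta m delta A) +oo%E.
  by move=> ->; rewrite addye ?leey // gt_eqF // (lt_le_trans _ (hausdorff_delta_ge0 B)).
have [|Boo] := eqVneq (hausdorff_delta m delta B) +oo%E.
  by move=> ->; rewrite addey ?leey // gt_eqF // (lt_le_trans _ (hausdorff_delta_ge0 A)).
have Afin : hausdorff_delta m delta A \is a fin_num.
  by rewrite ge0_fin_numE ?hausdorff_delta_ge0 // ltey.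
have Bfin : hausdorff_delta m delta B \is a fin_num.
  by rewrite ge0_fin_numE ?hausdorff_delta_ge0 // ltey.
apply/lee_addgt0Pr => e e0; have e20 : 0 < e / 2 by rewrite divr_gt0.
have [_ [U [AU Ud] <-] Ue] := lb_ereal_inf_adherent e20 Afin.
have [_ [V [BV Vd] <-] Ve] := lb_ereal_inf_adherent e20 Bfin.
rewrite [e]splitr EFinD addeACA; apply: le_trans (leeD (ltW Ue) (ltW Ve)).
apply: le_trans (nneseries_interleave_le _ _); try by move=> j; exact: diam_pow_ge0.
pose W j := if odd j then V j./2 else U j./2.
rewrite (_ : (fun _ => _) = (fun n => \sum_(0 <= j < n) diam_pow m (W j))%E); last first.
  by apply/funext => n; apply: eq_bigr => j _; rewrite /W; case: odd.
apply: hausdorff_delta_le => [x [/AU[j _ Ux]|/BV[j _ Vx]]|j].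
- by exists j.*2 => //; rewrite /W odd_double doubleK.
- by exists j.*2.+1 => //; rewrite /W /= odd_double /= uphalf_double.
- by rewrite /W; case: odd.
Qed.

(** A is covered by itself followed by empty sets, which have diameter -oo and contribute 0. *)
Lemma hausdorff_delta_diam_pow A : (diam A <= delta%:E)%E ->
  (hausdorff_delta m delta A <= diam_pow m A)%E.
Proof.
move=> Ad; pose U j := if j == 0%N then A else set0.
have := @hausdorff_delta_le A U; rewrite (nneseries_split _ 1); last first.
  by move=> j _; exact: diam_pow_ge0.
rewrite add0n big_nat1 eseries0 ?adde0 => [|j j1 _]; last first.
  by rewrite /U -(prednK j1) /diam_pow /= asboolT.
apply => [x Ax|j]; first by exists 0%N.
by rewrite /U; case: ifP => // _; rewrite diam_set0 leNye.
Qed.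

Lemma hausdorff_delta_bigcup (I : finType) (A : I -> set 'rV[R]_k) :
  (hausdorff_delta m delta (\bigcup_i A i) <=
   \sum_i hausdorff_delta m delta (A i))%E.
Proof.
rewrite bigcup_finType.
elim: (index_enum I) => [|i s IH].
  rewrite !big_nil; apply: le_trans (hausdorff_delta_diam_pow _) _.
    by rewrite diam_set0 leNye.
  by rewrite /diam_pow asboolT.
by rewrite !big_cons; apply: le_trans (hausdorff_deltaU _ _) (leeD _ _).
Qed.

Lemma hausdorff_delta_image_le A (r : R) (g : 'rV[R]_k -> 'rV[R]_k) :
  0 < r ->
  (forall x y, euclidean_dist (g x) (g y) <= r * euclidean_dist x y) ->
  (hausdorff_delta m (r * delta) (g @` A) <=
   (r ^+ m)%:E * hausdorff_delta m delta A)%E.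
Proof.
move=> r0 gr; have rm0 : 0 < r ^+ m by rewrite exprn_gt0.
rewrite -lee_pdivrMl //; apply: le_ereal_inf_tmp => _ [U [AU Ud] <-].
rewrite lee_pdivrMl // -nneseriesZl; last by move=> j _; exact: diam_pow_ge0.
apply: (@le_trans _ _ (\sum_(0 <= j <oo) diam_pow m (g @` U j))%E).
  apply: ereal_inf_lbound; exists (fun j => g @` U j) => //; split.
    by move=> _ [x /AU[j _ Ux] <-]; exists j => //; exists x.
  move=> j; apply: le_trans (diam_image_le _ r0 gr) _.
  by rewrite EFinM lee_pmul2l ?lte_fin.
apply: lee_nneseries => [j _ _|j _]; first exact: diam_pow_ge0.
exact: diam_pow_image_le.
Qed.

End HausdorffDelta.

Lemma unit_ball_volume_gt0 (R : realType) m : 0 < unit_ball_volume R m.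
Proof.
(* The recursion goes down by two, so two consecutive values are carried along. *)
suff: 0 < unit_ball_volume R m /\ 0 < unit_ball_volume R m.+1 by case.
elim: m => [|m [h1 h2]]; split => //=.
by rewrite mulr_gt0 // divr_gt0 // mulr_gt0 // pi_gt0.
Qed.

Section HausdorffMeasure.
Variables (R : realType) (k m : nat).
Implicit Types A B : set 'rV[R]_k.

Let c_gt0 : 0 < unit_ball_volume R m / 2 ^+ m.
Proof. by rewrite divr_gt0 ?unit_ball_volume_gt0 // exprn_gt0. Qed.

Lemma hausdorff_measure_le A (x : R) :
  (forall delta, 0 < delta -> (hausdorff_delta m delta A <= x%:E)%E) ->
  (hausdorff_measure m A <= (unit_ball_volume R m / 2 ^+ m * x)%:E)%E.
Proof.
move=> Ax; rewrite EFinM lee_pmul2l ?lte_fin //.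
by apply: ge_ereal_sup => _ [d d0 <-]; exact: Ax.
Qed.

Lemma le_hausdorff_measure_delta A (delta : R) : 0 < delta ->
  ((unit_ball_volume R m / 2 ^+ m)%:E * hausdorff_delta m delta A <=
   hausdorff_measure m A)%E.
Proof.
by move=> d0; rewrite lee_pmul2l ?lte_fin //; apply: ereal_sup_ubound; exists delta.
Qed.

Lemma hausdorff_measure_ge0 A : (0 <= hausdorff_measure m A)%E.
Proof.
apply: le_trans (le_hausdorff_measure_delta A ltr01).
by rewrite mule_ge0 ?hausdorff_delta_ge0 // lee_fin ltW.
Qed.

Lemma le_hausdorff_measure A B : A `<=` B ->
  (hausdorff_measure m A <= hausdorff_measure m B)%E.
Proof.
move=> AB; rewrite lee_pmul2l ?lte_fin //; apply: ge_ereal_sup => _ [d d0 <-].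
by apply: (le_trans (le_hausdorff_delta _ _ AB)); apply: ereal_sup_ubound; exists d.
Qed.

Lemma hausdorff_measureU A B :
  (hausdorff_measure m (A `|` B) <=
   hausdorff_measure m A + hausdorff_measure m B)%E.
Proof.
(* Factoring out the constant requires nonnegative suprema; delta = 1 witnesses this. *)
rewrite /hausdorff_measure -ge0_muleDr; first last.
- by apply: le_ereal_sup_tmp; exists (hausdorff_delta m 1 B); [exists 1 => /=|exact: hausdorff_delta_ge0].
- by apply: le_ereal_sup_tmp; exists (hausdorff_delta m 1 A); [exists 1 => /=|exact: hausdorff_delta_ge0].
rewrite lee_pmul2l ?lte_fin //; apply: ge_ereal_sup => _ [d d0 <-].
apply: le_trans (hausdorff_deltaU _ _ _ _) (leeD _ _).
  by apply: ereal_sup_ubound; exists d.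
by apply: ereal_sup_ubound; exists d.
Qed.

(** Carrying B along makes the base case of the induction B itself, so the measure of the empty set
    is never computed. *)
Lemma hausdorff_measureU_bigcup (I : finType) B (A : I -> set 'rV[R]_k) :
  (hausdorff_measure m (B `|` \bigcup_i A i) <=
   hausdorff_measure m B + \sum_i hausdorff_measure m (A i))%E.
Proof.
rewrite bigcup_finType.
elim: (index_enum I) => [|i s IH]; first by rewrite !big_nil setU0 adde0.
rewrite !big_cons setUCA addeCA.
by apply: le_trans (hausdorff_measureU _ _) (leeD _ _).
Qed.

Lemma hausdorff_measure_image_le A (r : R) (g : 'rV[R]_k -> 'rV[R]_k) :
  0 < r ->
  (forall x y, euclidean_dist (g x) (g y) <= r * euclidean_dist x y) ->
  (hausdorff_measure m (g @` A) <= (r ^+ m)%:E * hausdorff_measure m A)%E.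
Proof.
move=> r0 gr; rewrite /hausdorff_measure muleCA lee_pmul2l ?lte_fin //.
apply: ge_ereal_sup => _ [d d0 <-].
(* Covers of A at scale d / r give covers of the image at scale d; all positive scales are still
   available. *)
rewrite -[d](mulVKf (lt0r_neq0 r0)).
apply: le_trans (hausdorff_delta_image_le _ _ _ r0 gr) _.
rewrite lee_pmul2l ?lte_fin ?exprn_gt0 //; apply: ereal_sup_ubound.
by exists (r^-1 * d) => //=; rewrite mulr_gt0 // invr_gt0.
Qed.

End HausdorffMeasure.

(** * Lower bound for covers of a cube *)

Section CubeCovers.
Import numFieldNormedType.Exports.
Variables (R : realType) (m : nat).
Hypothesis m_gt0 : (0 < m)%N.

Let cube : set 'rV[R]_m := [set x | forall i, `[0, 1]%classic (x ord0 i)].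

Let grid (M : nat) (f : {ffun 'I_m -> 'I_M}) : 'rV[R]_m :=
  \row_i ((f i)%:R / M%:R).

(* A set of diameter d, with 1 <= d M, contains in each coordinate at most
   2 d M + 1 <= 3 d M points of the grid of mesh 1 / M. *)
Lemma card_grid_le (M : nat) (d : R) (S : {set {ffun 'I_m -> 'I_M}}) :
  1 <= d * M%:R ->
  (forall f g i, f \in S -> g \in S -> `|grid f 0 i - grid g 0 i| <= d) ->
  #|S|%:R <= (3 * d * M%:R) ^+ m.
Proof.
move=> dM hS; set K := Num.trunc (d * M%:R).
have dM0 : 0 <= d * M%:R by apply: le_trans dM.
have /andP[KdM dMK] := truncn_itv dM0; rewrite -/K in KdM dMK.
have M0 : 0 < M%:R :> R.
  by rewrite ltr0n lt0n; apply: contraL dM => /eqP ->; rewrite mulr0 -ltNge.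
have K0 : (0 < K)%N by rewrite -ltnS -(ltr_nat R) (le_lt_trans dM dMK).
have [->|[g gS]] := set_0Vmem S.
  by rewrite cards0 exprn_ge0 // -mulrA mulr_ge0.
(* Numerators differ by at most d M < K + 1, hence by at most K, being integers. So S lies in a box
   of side 2K + 1 around g. *)
have Sg f i : f \in S -> (f i <= g i + K)%N /\ (g i <= f i + K)%N.
  move=> fS; have := hS f g i fS gS; rewrite !mxE -mulrBl normrM.
  rewrite normfV (ger0_norm (ltW M0)) ler_pdivrMr //.
  rewrite ler_norml => /andP[h1 h2].
  by split; rewrite -ltnS -(ltr_nat R) -addnS natrD; lra.
pose F i := [pred a : 'I_M | (a <= g i + K)%N && (g i <= a + K)%N].
have cF i : (#|F i| <= K.*2.+1)%N.
  pose h (a : 'I_M) : 'I_(K.*2.+1) := inord (a + K - g i).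
  rewrite -[X in (_ <= X)%N]card_ord; apply: (@leq_card_in _ _ h).
  move=> a b; rewrite !inE => /andP[a1 a2] /andP[b1 b2] /(congr1 val) /=.
  by rewrite !inordK; [move=> ?; apply: val_inj => /=; lia|lia|lia].
have SF : (#|S| <= #|family F|)%N.
  apply: subset_leq_card; apply/fintype.subsetP => f fS; apply/familyP => i.
  by rewrite inE; apply/andP; exact: Sg.
have cfam : (#|family F| <= K.*2.+1 ^ m)%N.
  rewrite card_family foldrE big_image /=.
  rewrite -[X in (_ <= _ ^ X)%N]card_ord -prod_nat_const.
  by apply: leq_prod => i _; exact: cF.
apply: (@le_trans _ _ ((K.*2.+1)%:R ^+ m)).
  by rewrite -natrX ler_nat (leq_trans SF).
rewrite -mulrA lerXn2r ?nnegrE ?(mulr_ge0 _ dM0) //.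
(* 2K + 1 <= 3K since K >= 1. *)
apply: (@le_trans _ _ (3 * K%:R)); last by rewrite ler_pM2l.
by rewrite -natrM ler_nat; lia.
Qed.

(** Volume comparison by counting: for M large, the M^m grid points all lie in the cube, and V_j
    holds at most (3 d_j M)^m of them. Dividing by M^m gives the bound. *)
Lemma finite_cube_cover (I : eqType) (s : seq I) (V : I -> set 'rV[R]_m)
    (d : I -> R) :
  (forall j, 0 < d j) ->
  (forall j x y i, V j x -> V j y -> `|x 0 i - y 0 i| <= d j) ->
  cube `<=` \bigcup_(j in [set` s]) V j ->
  1 <= 3 ^+ m * \sum_(j <- s) d j ^+ m.
Proof.
move=> d0 Vd cV.
have [M M0 dM] : exists2 M : nat, (0 < M)%N &
    forall j, j \in s -> 1 <= d j * M%:R.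
  elim: (s) => [|j s' [M M0 IH]]; first by exists 1%N.
  exists (Num.trunc (d j)^-1 + M).+1 => // i.
  rewrite inE => /orP[/eqP ->|/IH h].
    rewrite -[leLHS](mulfV (lt0r_neq0 (d0 j))) ler_pM2l //.
    by apply: (le_trans (ltW (truncnS_gt (d j)^-1))); rewrite ler_nat ltnS leq_addr.
  by apply: (le_trans h); rewrite ler_pM2l // ler_nat ltnW // ltnS leq_addl.
pose S j : {set {ffun 'I_m -> 'I_M}} := [set f | `[< V j (grid f) >]]%SET.
have cS j : j \in s -> #|S j|%:R <= (3 * d j * M%:R) ^+ m.
  move=> js; apply: card_grid_le; first exact: dM.
  by move=> f g i; rewrite !inE; exact: Vd.
have Mm : (M ^ m <= \sum_(j <- s) #|S j|)%N.
  rewrite -[X in (X ^ _)%N]card_ord -[X in (_ ^ X)%N]card_ord -card_ffun.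
  (* Double counting: after exchanging the sums, each grid point must be counted at least once. *)
  under eq_bigr do rewrite -sum1_card big_mkcond.
  rewrite exchange_big -sum1_card /=; apply: leq_sum => f _.
  have /cV[j /= js Vj] : cube (grid f).
    move=> i /=; rewrite mxE in_itv /= divr_ge0 //=.
    by rewrite ler_pdivrMr ?ltr0n // mul1r ler_nat ltnW.
  by rewrite (big_rem j) //= inE asboolT.
have MR : 0 < M%:R ^+ m :> R by rewrite exprn_gt0 // ltr0n.
rewrite -(ler_pM2r MR) mul1r -natrX.
apply: (@le_trans _ _ (\sum_(j <- s) #|S j|)%N%:R); first by rewrite ler_nat.
rewrite natr_sum natrX mulr_sumr mulr_suml big_seq [leRHS]big_seq.
by apply: ler_sum => j js; rewrite -!exprMn; exact: cS.
Qed.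

(* Each W_j is enlarged to an open set by e_j = eps / 2^(j+1), so that
   finitely many suffice; (a + b)^m <= 2^m (a^m + b^m) absorbs the e_j. *)
Lemma countable_cube_cover (W : (set 'rV[R]_m)^nat) (D : nat -> R) :
  (forall j, 0 <= D j) ->
  (forall j x y i, W j x -> W j y -> `|x 0 i - y 0 i| <= D j) ->
  cube `<=` \bigcup_j W j ->
  (((6 ^+ m)^-1 / 2)%:E <= \sum_(0 <= j <oo) (D j ^+ m)%:E)%E.
Proof.
(* Half of 6^-m: compactness will give 2 eps <= sum + eps, which leaves eps. *)
move=> D0 WD cW; set eps : R := (6 ^+ m)^-1 / 2.
have p6 : 1 <= 6 ^+ m :> R by rewrite exprn_ege1 // ler1n.
have eps0 : 0 < eps by rewrite divr_gt0 // invr_gt0 (lt_le_trans ltr01).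
have eps1 : eps <= 1.
  rewrite ler_pdivrMr // (@le_trans _ _ 1) ?ler1n //; last by rewrite mul1r ler1n.
  by rewrite invf_le1 // (lt_le_trans ltr01).
pose e j : R := eps / (2 ^ j.+1)%:R.
have e0 j : 0 < e j by rewrite divr_gt0 // ltr0n expn_gt0.
have e1 j : e j <= 1.
  rewrite ler_pdivrMr ?ltr0n ?expn_gt0 // (le_trans eps1) // mul1r.
  by rewrite ler1n expn_gt0.
pose V j := \bigcup_(x in W j) (ball x (e j / 2))°.
have VD j x y i : V j x -> V j y -> `|x 0 i - y 0 i| <= D j + e j.
  move=> [x' Wx' /interior_subset[_ xx']] [y' Wy' /interior_subset[_ yy']].
  have := xx' 0 i; have := yy' 0 i; rewrite /ball /= => h1 h2.
  have h3 := WD _ _ _ i Wx' Wy'.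
  move: h1 h2 h3; rewrite !ltr_norml !ler_norml.
  by move=> /andP[? ?] /andP[? ?] /andP[? ?]; apply/andP; split; lra.
have : compact cube.
  rewrite /cube; apply: (@rV_compact R m (fun=> `[0 : R, 1 : R]%classic)) => i.
  exact: segment_compact.
rewrite compact_cover => /(_ _ setT V).
case=> [j _|x /cW[j _ Wx]|s _ sV].
- by apply: bigcup_open => x _; exact: open_interior.
- exists j => //; exists x => //; apply: nbhsx_ballx.
  by rewrite divr_gt0.
have := finite_cube_cover (fun j => ltr_wpDl (D0 j) (e0 j)) VD sV.
move=> h1; have h : 1 <= 6 ^+ m * \sum_(j <- finmap.enum_fset s) (D j ^+ m + e j).
  apply: (le_trans h1).
  have -> : 6 = 3 * 2 :> R by rewrite -natrM.
  rewrite exprMn -mulrA ler_pM2l ?exprn_gt0 //.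
  rewrite mulr_sumr; apply: ler_sum => j _.
  have h2 (a b : R) : 0 <= a -> 0 <= b -> (a + b) ^+ m <= 2 ^+ m * (a ^+ m + b ^+ m).
    wlog ab : a b / a <= b => [hw a0 b0|a0 b0].
      have [/hw|/ltW /hw] := leP a b; first exact.
      by rewrite addrC [X in _ * X]addrC; apply.
    apply: (@le_trans _ _ ((2 * b) ^+ m)).
      by rewrite lerXn2r ?nnegrE ?addr_ge0 ?mulr_ge0 //; lra.
    by rewrite exprMn ler_pM2l ?exprn_gt0 // lerDr exprn_ge0.
  apply: le_trans (h2 _ _ (D0 j) (ltW (e0 j))) _.
  (* e_j^m <= e_j because e_j <= 1 and m > 0, so the errors stay summable with total at most eps. *)
  rewrite ler_pM2l ?exprn_gt0 // lerD2l -[leRHS]expr1.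
  by rewrite ler_wiXn2l // ltW.
have h' : eps *+ 2 <= \sum_(j <- finmap.enum_fset s) (D j ^+ m + e j).
  rewrite -mulr_natr divfK // -[leLHS]mulr1 ler_pdivrMl //.
have h3 := @lee_sum_fset_lim R (fun j => (D j ^+ m)%:E + (e j)%:E)%E s xpredT.
have : ((eps *+ 2)%:E <= \sum_(0 <= j <oo) (D j ^+ m)%:E + eps%:E)%E.
  apply: (@le_trans _ _ (\sum_(0 <= j <oo) ((D j ^+ m)%:E + (e j)%:E))%E); last first.
    by apply: epsilon_trick => [j|]; rewrite ?lee_fin ?exprn_ge0 // ltW.
  apply: le_trans (h3 _); last by move=> j _; rewrite lee_fin addr_ge0 ?exprn_ge0 // ltW.
  by rewrite sumEFin lee_fin.
by rewrite mulr2n EFinD leeD2rE.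
Qed.

End CubeCovers.

(** * Volume of the simplex and of its corners *)

Section SimplexVolume.
Variables (R : realType) (m : nat).
Hypothesis m_gt0 : (0 < m)%N.

(** The last m coordinates are cut into cells of side 1 / M. The first coordinate, fixed by the sum,
    varies by at most m / M in a cell, and m^2 + m <= (m + 1)^2 bounds the diameter by (m + 1) / M.
    The (M + 1)^m cells give a bound free of delta, as M + 1 <= 2M. *)
Lemma hausdorff_delta_simplex_le (delta : R) : 0 < delta ->
  (hausdorff_delta m delta (simplex R m.+1) <= ((2 * m.+1)%:R ^+ m)%:E)%E.
Proof.
move=> d0; pose M := (Num.trunc (m.+1%:R / delta)).+1.
have M0 : 0 < M%:R :> R by rewrite ltr0n.
have Md : m.+1%:R / M%:R <= delta.
  by rewrite ler_pdivrMr // -ler_pdivrMl // mulrC ltW // truncnS_gt.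
(* The extra index M accommodates a coordinate equal to 1. *)
pose A (f : {ffun 'I_m -> 'I_M.+1}) : set 'rV[R]_m.+1 :=
  [set t | simplex R m.+1 t /\ forall i,
     (f i)%:R / M%:R <= t 0 (lift ord0 i) <= (f i).+1%:R / M%:R].
have cA : simplex R m.+1 `<=` \bigcup_f A f.
  move=> t [t0 t1].
  have tM i : 0 <= t 0 (lift ord0 i) * M%:R by rewrite mulr_ge0 // ltW.
  exists [ffun i => inord (Num.trunc (t 0 (lift ord0 i) * M%:R))] => //.
  split=> // i; have /andP[h1 h2] := truncn_itv (tM i).
  rewrite ffunE inordK ?ler_pdivrMr ?ler_pdivlMr ?h1 ?(ltW h2) //.
  rewrite ltnS -(ler_nat R) (le_trans h1) // ler_piMl //.
  by rewrite -[leRHS]t1 (bigD1 (lift ord0 i)) //= lerDl sumr_ge0.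
have dA f : (diam (A f) <= (m.+1%:R / M%:R)%:E)%E.
  apply: diam_le => x y [[_ x1] Ax] [[_ y1] Ay]; rewrite lee_fin.
  have xy i : `|x 0 (lift ord0 i) - y 0 (lift ord0 i)| <= M%:R^-1.
    have := Ax i; have := Ay i; rewrite -natr1 mulrDl mul1r ler_norml.
    by move=> /andP[? ?] /andP[? ?]; apply/andP; split; lra.
  apply: euclidean_dist_le; first by rewrite divr_ge0 // ltW.
  rewrite big_ord_recl.
  have h0 : `|x 0 ord0 - y 0 ord0| <= m%:R / M%:R.
    have -> : x 0 ord0 - y 0 ord0 =
        \sum_(i < m) (y 0 (lift ord0 i) - x 0 (lift ord0 i)).
      by rewrite sumrB; move: x1 y1; rewrite !big_ord_recl; lra.
    apply: (le_trans (ler_norm_sum _ _ _)).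
    rewrite mulr_natl -[X in _ <= _ *+ X]card_ord -sumr_const.
    by apply: ler_sum => i _; rewrite distrC.
  have sq (u v : R) : `|u| <= v -> u ^+ 2 <= v ^+ 2.
    by move=> uv; rewrite -real_normK ?num_real // lerXn2r ?nnegrE // (le_trans _ uv).
  apply: (@le_trans _ _ ((m%:R / M%:R) ^+ 2 + \sum_(i < m) M%:R^-1 ^+ 2)).
    by rewrite lerD ?sq //; apply: ler_sum => i _; exact: sq.
  rewrite sumr_const card_ord -mulr_natl -natr1.
  have := mulr_ge0 (ler0n R m) (sqr_ge0 M%:R^-1); have := sqr_ge0 (M%:R^-1 : R).
  by lra.
apply: le_trans (le_hausdorff_delta _ _ cA) _.
apply: le_trans (hausdorff_delta_bigcup _ _ _) _.
apply: (@le_trans _ _ (\sum_(f : {ffun 'I_m -> 'I_M.+1}) ((m.+1%:R / M%:R) ^+ m)%:E)%E).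
  apply: lee_sum => f _.
  apply: le_trans (hausdorff_delta_diam_pow _ _) _.
    by apply: le_trans (dA f) _; rewrite lee_fin.
  by apply: diam_pow_le => //; rewrite divr_ge0 // ltW.
rewrite sumEFin lee_fin sumr_const card_ffun !card_ord -[leLHS]mulr_natr natrX -exprMn.
rewrite lerXn2r ?nnegrE ?mulr_ge0 ?invr_ge0 ?ler0n //.
rewrite natrM [2 * _]mulrC -mulrA ler_pM2l ?ltr0n // ler_pdivrMl //.
by rewrite -natrM ler_nat; lia.
Qed.

(** A cover of the simplex is pulled back to the unit cube along [phi], which divides by m so that
    the coordinates sum to at most 1 and puts the remainder in front. Coordinate spreads of the
    preimages are at most m times the diameters, so the cube bound applies. *)
Lemma hausdorff_delta_simplex_ge (delta : R) :
  (((m%:R ^+ m)^-1 * ((6 ^+ m)^-1 / 2))%:E <=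
   hausdorff_delta m delta (simplex R m.+1))%E.
Proof.
have mR : 0 < m%:R :> R by rewrite ltr0n.
apply: le_ereal_inf_tmp => _ [U [EU Ud] <-].
pose phi (x : 'rV[R]_m) : 'rV[R]_m.+1 := \row_i
  if unlift ord0 i is Some j then x 0 j / m%:R else 1 - \sum_j x 0 j / m%:R.
have phiE x i : phi x 0 (lift ord0 i) = x 0 i / m%:R by rewrite mxE liftK.
pose D j := m%:R * fine (diam (U j)).
have D0 j : 0 <= D j by rewrite mulr_ge0 // fine_diam_ge0.
rewrite EFinM lee_pdivrMl ?exprn_gt0 // -nneseriesZl; last first.
  by move=> j _; exact: diam_pow_ge0.
rewrite (eq_eseriesr (g := fun j => (D j ^+ m)%:E)); last first.
  by move=> j _; rewrite (diam_powE m_gt0 (Ud j)) -EFinM -exprMn.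
apply: (@countable_cube_cover _ _ m_gt0 (fun j => phi @^-1` U j)) => //.
- move=> j x y i /= Ux Uy; rewrite -ler_pdivrMl //.
  have -> : m%:R^-1 * `|x 0 i - y 0 i| =
      `|phi x 0 (lift ord0 i) - phi y 0 (lift ord0 i)|.
    by rewrite !phiE -mulrBl normrM normfV (ger0_norm (ltW mR)) mulrC.
  apply: le_trans (le_euclidean_dist _ _ _) _.
  rewrite -lee_fin fineK ?le_diam //.
  (* [fine] is faithful here: [U j] contains [phi x], so its diameter is nonnegative, and it is at
     most delta. *)
  rewrite fin_numE -ltey (le_lt_trans (Ud j)) ?ltry // andbT.
  by rewrite gt_eqF // (lt_le_trans _ (diam_ge0 _)) //; exists (phi x).
- move=> x x01.
  have xi i : 0 <= x 0 i / m%:R <= m%:R^-1.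
    have := x01 i; rewrite /= in_itv /= => /andP[? ?].
    by rewrite divr_ge0 //= ler_piMl // invr_ge0.
  have : simplex R m.+1 (phi x).
    split=> [i|].
      rewrite mxE; case: unliftP => [j _|_]; first by case/andP: (xi j).
      rewrite subr_ge0 -[leRHS](mulfV (lt0r_neq0 mR)) mulr_natl.
      rewrite -[X in _ <= _ *+ X]card_ord -sumr_const.
      by apply: ler_sum => i' _; case/andP: (xi i').
    rewrite big_ord_recl; under eq_bigr do rewrite phiE.
    by rewrite mxE unlift_none subrK.
  by case/EU=> j _ Uj; exists j.
Qed.

Lemma hausdorff_measure_simplex_gt0 : (0 < hausdorff_measure m (simplex R m.+1))%E.
Proof.
apply: lt_le_trans (le_hausdorff_measure_delta _ _ ltr01).
have c0 : 0 < unit_ball_volume R m / 2 ^+ m.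
  by rewrite divr_gt0 ?unit_ball_volume_gt0 // exprn_gt0.
rewrite mule_gt0 ?lte_fin //.
apply: lt_le_trans (hausdorff_delta_simplex_ge _).
by rewrite lte_fin mulr_gt0 ?divr_gt0 ?invr_gt0 ?exprn_gt0 ?ltr0n.
Qed.

Lemma hausdorff_measure_simplex_lty : (hausdorff_measure m (simplex R m.+1) < +oo)%E.
Proof.
apply: le_lt_trans (ltry _).
exact: hausdorff_measure_le hausdorff_delta_simplex_le.
Qed.

Lemma hausdorff_measure_corner_le (T : R) (i : 'I_m.+1) : T < 1 ->
  (hausdorff_measure m [set t | simplex R m.+1 t /\ (T <= t 0 i)%R] <=
   ((1 - T) ^+ m)%:E * hausdorff_measure m (simplex R m.+1))%E.
Proof.
move=> T1; have r0 : 0 < 1 - T by rewrite subr_gt0.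
pose g (x : 'rV[R]_m.+1) : 'rV[R]_m.+1 :=
  \row_j ((1 - T) * x 0 j + T * (j == i)%:R).
apply: le_trans (hausdorff_measure_image_le (g := g) m _ r0 _); last first.
  move=> x y; apply: euclidean_dist_le.
    by rewrite mulr_ge0 ?euclidean_dist_ge0 // ltW.
  rewrite exprMn sqr_sqrtr; last by apply: sumr_ge0 => j _; exact: sqr_ge0.
  rewrite mulr_sumr; apply: ler_sum => j _; rewrite !mxE -exprMn.
  by rewrite opprD addrACA subrr addr0 mulrBr.
apply: le_hausdorff_measure => t [[t0 t1] Tt].
(* The inverse of [g], the homothety with centre e_i; its ith coordinate is nonnegative because t_i
   >= T. *)
exists (\row_j ((t 0 j - T * (j == i)%:R) / (1 - T))); last first.
  apply/rowP => j; rewrite !mxE mulrC divfK ?subrK //.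
  exact: lt0r_neq0.
split=> [j|].
  rewrite mxE divr_ge0 ?(ltW r0) // subr_ge0.
  by have [->|] := eqVneq j i; rewrite ?mulr1 ?mulr0.
under eq_bigr do rewrite mxE.
rewrite -mulr_suml sumrB t1 -mulr_sumr (bigD1 i) //= eqxx big1 => [|j /negbTE -> //].
by rewrite addr0 mulr1 divff // lt0r_neq0.
Qed.

End SimplexVolume.

(** * Comparison of the risks and conclusion *)

(** Each t_j^2 is at most t_j times the largest coordinate, and the t_j sum to 1. *)
Lemma simplex_sqnorm_le_max (R : realType) m (t : 'rV[R]_m.+1) :
  simplex R m.+1 t -> exists i, \sum_j t 0 j ^+ 2 <= t 0 i.
Proof.
move=> [t0 t1]; exists [arg max_(i > ord0) t 0 i]%O.
case: arg_maxP => // i _ ti; rewrite -[leRHS]mulr1 -t1 mulr_sumr.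
by apply: ler_sum => j _; rewrite expr2 ler_wpM2r //; exact: ti.
Qed.

(** The hypothesis is S < T with the denominator cleared. After cross-multiplication the difference
    of the risks factors as n k C times an affine function of S, whose positivity is that
    hypothesis. *)
Lemma risk_dirichlet_bayes_lt (R : realType) (k n : nat) (C : R) (t : 'rV[R]_k) :
  (0 < k)%N -> (0 < n)%N -> 0 < C -> \sum_i t 0 i = 1 ->
  (\sum_i t 0 i ^+ 2) * (2 * n%:R + k%:R * C + n%:R * k%:R * C) <
    2 * n%:R + k%:R * C + n%:R * C ->
  risk (dirichlet_bayes k n C) t < risk (mle R k n) t.
Proof.
move=> k0 n0 C0 t1; set S := \sum_i t 0 i ^+ 2 => hS.
have kR : 0 < k%:R :> R by rewrite ltr0n.
have nR : 0 < n%:R :> R by rewrite ltr0n.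
have NR : 0 < n%:R + k%:R * C by rewrite addr_gt0 // mulr_gt0.
have -> : mle R k n = fun c => \row_i (((c i)%:R + 0) / n%:R).
  by apply/funext => c; apply/rowP => i; rewrite !mxE addr0.
rewrite /dirichlet_bayes !risk_affine ?lt0r_neq0 // -/S.
rewrite subrr [X in _ < (_ + X) / _]big1 ?addr0 => [|i _]; last first.
  by rewrite mul0r subrr expr0n.
have -> : \sum_(i < k) (C - (n%:R + k%:R * C - n%:R) * t 0 i) ^+ 2 =
    C ^+ 2 * (k%:R ^+ 2 * S - k%:R).
  transitivity (\sum_(i < k) (C ^+ 2 - 2 * k%:R * C ^+ 2 * t 0 i +
      (k%:R * C) ^+ 2 * t 0 i ^+ 2)).
    by apply: eq_bigr => i _; ring.
  rewrite big_split /= sumrB sumr_const card_ord -!mulr_sumr t1 -/S -mulr_natr.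
  by ring.
rewrite ltr_pdivrMr ?exprn_gt0 // [ltRHS]mulrAC ltr_pdivlMr ?exprn_gt0 // -subr_gt0.
rewrite (_ : _ - _ = n%:R * k%:R * C *
   ((2 * n%:R + k%:R * C) * (1 - S) - n%:R * C * (k%:R * S - 1))); last by ring.
by rewrite !mulr_gt0 //; lra.
Qed.

Theorem theorem3p3 (R : realType) (k n : nat) (C : R)
  (hk : (3 <= k)%N) (hn : (k <= n)%N) (hC0 : 0 < C)
  (hC : ~ (k = 3%N /\ n = 3%N) ->
        C < 2 * n%:R / (n%:R * (k%:R - 2) - k%:R)) :
  Vol [set t : 'rV[R]_k | simplex R k t /\
         risk (dirichlet_bayes k n C) t < risk (mle R k n) t]
    / Vol (simplex R k)
  > 1 - k%:R * (1 / 4) `^ ((k%:R - 1) / 2).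
Proof.
have kR : 3 <= k%:R :> R by rewrite ler_nat.
have nkR : k%:R <= n%:R :> R by rewrite ler_nat.
(* Division-free form of the bound on C, trivial when n(k - 2) - k <= 0; it is equivalent to T >
   1/2. *)
have hC' : C * (n%:R * (k%:R - 2) - k%:R) < 2 * n%:R.
  have [[-> ->]|/hC] := pselect (k = 3%N /\ n = 3%N); first lra.
  have [d0|] := ltP 0 (n%:R * (k%:R - 2) - k%:R : R).
    by rewrite ltr_pdivlMr.
  by nra.
set Q := 2 * n%:R + k%:R * C + n%:R * k%:R * C.
have Q0 : 0 < Q by rewrite !addr_gt0 // !mulr_gt0 //; lra.
set T := (2 * n%:R + k%:R * C + n%:R * C) / Q.
have T12 : 1 / 2 < T by rewrite ltr_pdivlMr // /Q; lra.
(* T < 1 amounts to nC < nkC; it makes the ratio 1 - T of the corners positive. *)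
have T1 : T < 1.
  rewrite ltr_pdivrMr // mul1r /Q ltrD2l ltr_pM2r //.
  by rewrite ltr_pMr //; lra.
case: k => [//|m] in hk hn hC kR nkR hC' Q Q0 T T12 T1 *.
have m0 : (0 < m)%N by case: m hk {hn hC kR nkR hC' Q Q0 T T12 T1}.
have n0 : (0 < n)%N by exact: leq_ltn_trans hn.
rewrite /Vol /=; set E := simplex R m.+1; set G := [set t | _].
have E0 := hausdorff_measure_simplex_gt0 R m0.
have Efin : hausdorff_measure m E \is a fin_num.
  by rewrite ge0_fin_numE ?ltW // hausdorff_measure_simplex_lty.
have Gfin : hausdorff_measure m G \is a fin_num.
  rewrite ge0_fin_numE ?hausdorff_measure_ge0 //.
  apply: le_lt_trans (le_hausdorff_measure _ _) (hausdorff_measure_simplex_lty _ m0).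
  by move=> t [].
pose K i := [set t | E t /\ T <= t 0 i].
(* If S >= T, the largest coordinate is at least S, hence at least T; otherwise the Bayes risk is
   smaller. *)
have cover : E `<=` G `|` \bigcup_i K i.
  move=> t Et; have [i Si] := simplex_sqnorm_le_max Et.
  have [TS|ST] := leP T (\sum_j t 0 j ^+ 2).
    by right; exists i => //; split => //; exact: le_trans Si.
  left; split; first exact: Et.
  apply: (risk_dirichlet_bayes_lt _ n0 hC0); [by []|by case: Et|].
  by rewrite -ltr_pdivlMr.
have := le_trans (le_hausdorff_measure m cover) (hausdorff_measureU_bigcup _ _ _).
move=> /le_trans/(_ (leeD (lexx _) (lee_sum _ (fun i _ => hausdorff_measure_corner_le i T1)))).
(* All measures being finite, the inequality becomes the real one v <= g + k (1 - T)^m v. *)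
rewrite -(fineK Efin) -(fineK Gfin) -EFinM sumEFin -EFinD lee_fin.
set v := fine _; set g := fine _ => vg.
have v0 : 0 < v by rewrite fine_gt0 // E0 ltey_eq Efin.
rewrite sumr_const card_ord -mulr_natl in vg.
rewrite ltr_pdivlMr //; apply: (@lt_le_trans _ _ ((1 - m.+1%:R * (1 - T) ^+ m) * v)); last first.
  by rewrite mulrBl mul1r lerBlDr -mulrA.
rewrite ltr_pM2r // ltrD2l ltrN2 ltr_pM2l ?ltr0n //.
(* With m = k - 1, (1/4)^(m/2) = (1/2)^m; the final strictness comes from 1 - T < 1/2 and m > 0. *)
have -> : (1 / 4) `^ ((m.+1%:R - 1) / 2) = (1 / 2) ^+ m :> R.
  have -> : 1 / 4 = (1 / 2) `^ 2%:R :> R by rewrite powR_mulrn //; lra.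
  rewrite -powRrM -[m.+1%:R]natr1 addrK [2 * _]mulrC divfK // powR_mulrn //; lra.
by rewrite ltrXn2r ?nnegrE -?lt0n //; lra.
Qed.
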